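(* We have \[ \sum_{n=0}^{\infty}\sum_{\pi\in\mathfrak{S}_{n}}s^{\mathrm{pix}(\pi)}t^{\mathrm{des}(\pi)}\frac{x^{n}}{n!} =\frac{(1-t)\left((1-s)(1-s-t)te^{(s-t)x}+(1-t)\left((1-s)(s-t)e^{(s+t-1)x}-t(1-2t)\right)\right)}{(1-2t)(1-s-t)(s-t)\left(e^{(t-1)x}-t\right)}. \]
   Context: Permutations $\pi\in\mathfrak{S}_n$ are written in one-line notation $\pi=\pi_1\cdots\pi_n$; $\mathfrak{S}_0$ consists of the empty permutation. An index $i\in[n-1]$ is a descent of $\pi$ if $\pi_i>\pi_{i+1}$, and $\mathrm{des}(\pi)$ counts descents; $i\in[n]$ is an ascent if it is not a descent (so $n$ is always an ascent). A desarrangement is a permutation (or word with distinct letters, via standardization) whose first ascent is even; the empty word is a desarrangement. Every permutation $\pi$ can be written uniquely as a concatenation $\pi=\iota\delta$ where $\iota$ is an increasing (possibly empty) sequence and $\delta$ is a desarrangement (the pixed factorization); the letters of $\iota$ are the pixed points of $\pi$, and $\mathrm{pix}(\pi)=|\iota|$. The identity is of formal power series in $x$. *)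

(* Defs.v *)
From HB Require Import structures.
From mathcomp Require Import all_boot all_order all_algebra all_fingroup.
From mathcomp Require Import mpoly.

Set Implicit Arguments.
Unset Strict Implicit.
Unset Printing Implicit Defensive.

Import GRing.Theory.

(* Words are sequences of natural numbers with distinct letters. Positions are
   numbered from 1, so the letter w_i is [nth 0 w i.-1].  Every statistic below
   depends only on the relative order of the letters, hence is invariant under
   standardization. *)

Definition oneline n (p : 'S_n) : seq nat := [seq (p i).+1 | i <- enum 'I_n].

Definition is_descent (w : seq nat) (i : nat) : bool :=
  (0 < i < size w) && (nth 0 w i < nth 0 w i.-1).

Definition is_ascent (w : seq nat) (i : nat) : bool :=
  (0 < i <= size w) && ~~ is_descent w i.

Definition des (w : seq nat) : nat := count (is_descent w) (iota 1 (size w).-1).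

(* Meaningful for nonempty [w] only: then [size w] is an ascent. *)
Definition first_ascent (w : seq nat) : nat :=
  (find (is_ascent w) (iota 1 (size w))).+1.

Definition desarrangement (w : seq nat) : bool :=
  (w == [::]) || ~~ odd (first_ascent w).

(* The cut of [w] after its first [k] letters is a pixed factorization. *)
Definition pixed_cut (w : seq nat) (k : nat) : bool :=
  [&& k <= size w, sorted ltn (take k w) & desarrangement (drop k w)].

(* The length of the increasing factor of the pixed factorization; the lemmas
   [pixP] and [pixed_cut_uniq] show that it is well defined. *)
Definition pix (w : seq nat) : nat := find (pixed_cut w) (iota 0 (size w).+1).

Lemma first_ascent_cons a b u :
  first_ascent [:: a, b & u] =
    if b < a then (first_ascent (b :: u)).+1 else 1.
Proof.
rewrite /first_ascent /=.
have -> : is_ascent [:: a, b & u] 1 = ~~ (b < a) by [].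
case: (b < a) => //=; congr _.+2.
have -> : (if is_ascent (b :: u) 1 then 0 else
          (find (is_ascent (b :: u)) (iota 2 (size u))).+1)
        = find (is_ascent (b :: u)) (iota 1 (size u).+1) by [].
have -> : (if is_ascent [:: a, b & u] 2 then 0 else
          (find (is_ascent [:: a, b & u]) (iota 3 (size u))).+1)
        = find (is_ascent [:: a, b & u]) (iota (1 + 1) (size u).+1) by [].
rewrite iotaDl find_map; apply: eq_in_find => i.
rewrite mem_iota => /andP[i_gt0 _].
by case: i i_gt0.
Qed.

Lemma desarrangement_cons a u :
  desarrangement (a :: u) = ~~ odd (first_ascent (a :: u)).
Proof. by []. Qed.

Lemma desarrangement_cons2 a u :
  desarrangement u -> desarrangement (a :: u) = false.
Proof.
case: u => [//|b u].
rewrite !desarrangement_cons first_ascent_cons.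
by case: ifP => //= _ /negbTE ->.
Qed.

Lemma pixed_cut_cons a u k :
  pixed_cut u k -> desarrangement (a :: u) = false -> uniq (a :: u) ->
  pixed_cut (a :: u) k.+1.
Proof.
rewrite /pixed_cut /= ltnS => /and3P[-> su du] nd /andP[au _].
rewrite du andbT /=.
case: k su du => [|k]; first by rewrite take0.
case: u nd au => [//|b u] nd au /= su du.
rewrite su andbT.
have nb : desarrangement (b :: u) = false.
  case: k su du => [|k] su du; first by apply: desarrangement_cons2; rewrite drop0 in du.
  case: u su nd au du => [//|c u] /= /andP[bc _] _ _ _.
  by rewrite !desarrangement_cons first_ascent_cons ltnNge (ltnW bc).
move: nd nb; rewrite !desarrangement_cons first_ascent_cons.
case: ltngtP => // [_|ab]; last by rewrite ab mem_head in au.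
by rewrite oddS negbK => ->.
Qed.

Lemma pixed_cut_exists w : uniq w -> exists k, pixed_cut w k.
Proof.
elim: w => [|a u IH] uw; first by exists 0.
have [k ku] := IH (proj2 (andP uw)).
case: (boolP (desarrangement (a :: u))) => [d|/negbTE nd].
  by exists 0; rewrite /pixed_cut /= d.
by exists k.+1; apply: pixed_cut_cons.
Qed.

Lemma pixP w : uniq w -> pixed_cut w (pix w).
Proof.
move=> /pixed_cut_exists [k kw].
have h : has (pixed_cut w) (iota 0 (size w).+1).
  apply/hasP; exists k => //; rewrite mem_iota /= add0n ltnS.
  by case/and3P: kw.
have := nth_find 0 h; rewrite nth_iota ?add0n //.
by move: h; rewrite has_find size_iota.
Qed.

Lemma pixed_cut_uniq w j k : pixed_cut w j -> pixed_cut w k -> j = k.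
Proof.
wlog jk : j k / j <= k.
  move=> H cj ck; case: (leqP j k) => [|/ltnW] h; first exact: H.
  by apply/esym/H.
elim: w j k jk => [|a u IH] j k jk.
  by rewrite /pixed_cut !leqn0 => /and3P[/eqP-> _ _] /and3P[/eqP-> _ _].
case: j jk => [|j]; case: k => [|k] //= jk.
  rewrite /pixed_cut /= => d /and3P[_ s dk]; exfalso; move: d.
  case: k s dk jk => [|k] s dk _.
    by rewrite drop0 in dk; rewrite (desarrangement_cons2 a dk).
  case: u s {IH dk} => [//|b u] /= /andP[ab _].
  by rewrite !desarrangement_cons first_ascent_cons ltnNge (ltnW ab).
rewrite /pixed_cut /= !ltnS => /and3P[h1 h2 h3] /and3P[h4 h5 h6].
congr _.+1; apply: IH => //; rewrite /pixed_cut ?h1 ?h3 ?h4 ?h6 /= andbT.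
- exact: path_sorted h2.
- exact: path_sorted h5.
Qed.

(* A formal power series in x is given by the sequence of its coefficients:
   [f] stands for \sum_n f n x^n. *)
Declare Scope fps_scope.
Delimit Scope fps_scope with fps.

Section FormalPowerSeries.
Local Open Scope ring_scope.
Variable F : fieldType.

Definition fps := nat -> F.
Implicit Types (f g : fps) (c : F).

Definition fps_const c : fps := fun n => if n is 0 then c else 0.
Definition fps_add f g : fps := fun n => f n + g n.
Definition fps_sub f g : fps := fun n => f n - g n.
Definition fps_scale c f : fps := fun n => c * f n.
Definition fps_mul f g : fps := fun n => \sum_(i < n.+1) f i * g (n - i)%N.

(* The first n+1 coefficients of 1/f, obtained by solving
   f 0 * h n + f 1 * h (n-1) + ... + f n * h 0 = (n == 0) for h n. *)
Fixpoint fps_inv_seq f (n : nat) : seq F :=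
  if n is m.+1 then
    let h := fps_inv_seq f m in
    rcons h (- (f 0)^-1 * \sum_(i < m.+1) f i.+1 * h`_(m - i))
  else [:: (f 0)^-1].

(* The multiplicative inverse of a series with nonzero constant coefficient;
   see [fps_mulV]. *)
Definition fps_inv f : fps := fun n => (fps_inv_seq f n)`_n.

(* e^(c x) *)
Definition fps_exp c : fps := fun n => c ^+ n / n`!%:R.

Lemma size_fps_inv_seq f n : size (fps_inv_seq f n) = n.+1.
Proof. by elim: n => //= n IH; rewrite size_rcons IH. Qed.

Lemma nth_fps_inv_seq f n i : (i <= n)%N -> (fps_inv_seq f n)`_i = fps_inv f i.
Proof.
elim: n => [|n IH]; first by rewrite leqn0 => /eqP->.
rewrite leq_eqVlt => /predU1P[->//|]; rewrite ltnS => lin.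
by rewrite /= nth_rcons size_fps_inv_seq ltnS lin IH.
Qed.

Lemma fps_mulV f : f 0 != 0 -> fps_mul f (fps_inv f) =1 fps_const 1.
Proof.
move=> f0 [|n]; rewrite /fps_mul big_ord_recl subn0.
  by rewrite big_ord0 addr0 /fps_inv /= mulfV.
rewrite {1}/fps_inv /= nth_rcons size_fps_inv_seq ltnn eqxx mulrA mulrN mulfV //.
rewrite mulN1r addrC; apply/eqP; rewrite subr_eq0; apply/eqP.
by apply: eq_bigr => i _; rewrite nth_fps_inv_seq ?leq_subr.
Qed.

End FormalPowerSeries.

Notation "c %:S" := (fps_const c) (at level 1, format "c %:S") : fps_scope.
Notation "f + g" := (fps_add f g) : fps_scope.
Notation "f - g" := (fps_sub f g) : fps_scope.
Notation "c *: f" := (fps_scale c%R f) : fps_scope.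
Notation "f / g" := (fps_mul f (fps_inv g)) : fps_scope.
Notation "''e^' ( c 'x)'" := (fps_exp c%R)
  (at level 0, c at level 99, format "''e^' ( c  'x)'") : fps_scope.

(* The coefficient field Q(s, t), with s and t independent indeterminates. *)
Notation Qst := {fraction {mpoly rat[2]}}.

Definition s : Qst := tofrac ('X_ord0).
Definition t : Qst := tofrac ('X_ord_max).

Definition pix_des_egf : fps Qst := fun n =>
  ((\sum_(p : 'S_n) s ^+ pix (oneline p) * t ^+ des (oneline p)) / n`!%:R)%R.

(* Main.v *)
Require Import Defs.
From HB Require Import structures.
From mathcomp Require Import all_boot all_order all_algebra all_fingroup.
From mathcomp Require Import mpoly.
From mathcomp Require Import boolp.
From mathcomp Require Import ring.

(* Cut a word at its largest letter, [w = u m v].  If [u] is not increasing,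
   then [pix w = pix u]; if it is, then [pix w] is [size u + 1] when [v] is a
   desarrangement and [size u] otherwise.  Moreover
   [des w = des u + des v + (v != [::])].  Writing G_s for the exponential
   generating function, A = G_1 (all words) and D = G_0 (desarrangements), this
   says
     G_s' = (G_s - e^(sx)) (1 - t + t A)
            + e^(sx) (s - t s + t ((s - 1) D + A)),   G_s(0) = 1.
   For s = 1 the equation is A' = A (1 - t + t A), so A = (1 - t) / q with
   q = e^((t-1)x) - t.  Setting G_s = A y_s linearises it into
   y_s' = (s - 1) e^(sx) (q + t y_0), which is solved first for s = 0 and then
   for every s by a combination of exponentials.  Conversely the recurrence
   determines the coefficients, so it suffices to check that the closed form
   satisfies the differential equation. *)

Set Implicit Arguments.
Unset Strict Implicit.
Unset Printing Implicit Defensive.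

Import GRing.Theory.

(** * Statistics of a word cut at its largest letter *)

Lemma des_cons a b u : des [:: a, b & u] = (b < a) + des (b :: u).
Proof.
rewrite /des /= -[2]/(1 + 1) iotaDl count_map.
have -> : is_descent [:: a, b & u] 1 = (b < a) by [].
congr (_ + _); apply: eq_in_count => i; rewrite mem_iota => /andP[i_gt0 _].
by case: i i_gt0.
Qed.

(** The step into the largest letter [m] is never a descent, and the step out of it always is one,
    provided [v] has a letter. *)
Lemma des_split m u v : all (ltn^~ m) u -> all (ltn^~ m) v ->
  des (u ++ m :: v) = des u + des v + (v != [::]).
Proof.
elim: u => [|a [|b u] IH] /=.
- by case: v => [//|c v] _ /= /andP[cm _]; rewrite des_cons cm addnC.
- move=> /andP[am _] av; rewrite des_cons ltnNge (ltnW am) add0n.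
  exact: IH.
- move=> /andP[_ au] av.
  by rewrite !des_cons -!addnA; congr (_ + _); rewrite addnA -IH.
Qed.

Lemma des_sorted w : sorted ltn w -> des w = 0.
Proof.
elim: w => [//|a [//|b u] IH] /= /andP[ab bu].
by rewrite des_cons ltnNge (ltnW ab) IH.
Qed.

Lemma pixed_cut_pix w k : uniq w -> pixed_cut w k -> pix w = k.
Proof. by move=> /pixP /pixed_cut_uniq; apply. Qed.

(** This makes the weight at s = 0 select the desarrangements, since [0 ^+ pix w] is then their
    indicator. *)
Lemma pix_eq0 w : uniq w -> (pix w == 0) = desarrangement w.
Proof.
move=> uw; apply/eqP/idP => [w0|dw].
  by have := pixP uw; rewrite w0 /pixed_cut drop0 => /and3P[].
by apply: pixed_cut_pix => //; rewrite /pixed_cut take0 drop0 dw.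
Qed.

Lemma pix_sorted w : uniq w -> sorted ltn w -> pix w = size w.
Proof.
move=> uw sw; apply: pixed_cut_pix => //.
by rewrite /pixed_cut leqnn take_size sw drop_size.
Qed.

(** The last position of [d] is an ascent in both words: by convention in [d], and because [m] is
    larger in the longer word. Hence the first ascent occurs inside [d] in either case. *)
Lemma first_ascent_cat m d v : d != [::] -> all (ltn^~ m) d ->
  first_ascent (d ++ m :: v) = first_ascent d.
Proof.
elim: d => [//|a [|b d] IH] _ /= /andP[am ad].
  by rewrite first_ascent_cons ltnNge (ltnW am).
by rewrite !first_ascent_cons -IH.
Qed.

Lemma sorted_rcons_ltn m u :
  sorted ltn u -> all (ltn^~ m) u -> sorted ltn (rcons u m).
Proof.
case: u => [//|a u] /=; rewrite rcons_path => -> /= /andP[am au].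
by have := mem_last a u; rewrite inE => /predU1P[->//|/(allP au)].
Qed.

(** By uniqueness it is enough to exhibit a pixed cut. For increasing [u] it lies after [m] if [v]
    is a desarrangement. Otherwise [v] is nonempty with odd first ascent, the descent out of [m]
    makes it even, and the cut lies before [m]. For other [u] the cut of [u] still works. *)
Lemma pix_split m u v :
  uniq (u ++ m :: v) -> all (ltn^~ m) u -> all (ltn^~ m) v ->
  pix (u ++ m :: v) =
    if sorted ltn u then size u + desarrangement v else pix u.
Proof.
move=> uw au av; apply: pixed_cut_pix => //.
have uu : uniq u by move: uw; rewrite cat_uniq => /andP[].
case: ifP => [su|nsu].
  case: (boolP (desarrangement v)) => [dv|ndv].
    rewrite /pixed_cut -cat_rcons size_cat size_rcons addn1 leq_addr.
    rewrite -(size_rcons u m) take_size_cat // drop_size_cat // dv andbT.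
    exact: sorted_rcons_ltn.
  rewrite /pixed_cut addn0 size_cat leq_addr take_size_cat // drop_size_cat //.
  rewrite su desarrangement_cons; case: v ndv av {uw} => [//|b v] nd /andP[bm _].
  by rewrite first_ascent_cons (bm : b < m) oddS negbK;
    rewrite desarrangement_cons negbK in nd.
have /and3P[ku sk dk] := pixP uu.
(* A cut at the end would make [u] increasing. So the desarrangement factor of [u] is nonempty, and
   appending [m :: v] keeps its first ascent. *)
have ltk : pix u < size u.
  rewrite ltn_neqAle ku andbT; apply/eqP => ek.
  by move: sk; rewrite ek take_size nsu.
rewrite /pixed_cut size_cat (leq_trans ku) ?leq_addr // takel_cat // sk.
rewrite drop_cat ltk; have: drop (pix u) u != [::].
  by rewrite -size_eq0 size_drop subn_eq0 -ltnNge.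
have: all (ltn^~ m) (drop (pix u) u).
  by apply/allP => x /mem_drop /(allP au).
case: (drop _ _) dk => [//|a d]; rewrite !desarrangement_cons => dk ad _.
by rewrite -cat_cons first_ascent_cat.
Qed.

(** * Sums over all arrangements of a finite set of letters *)

Section SplitAtLetter.
Variables (T : finType) (R : nmodType).
Local Open Scope ring_scope.

Lemma cat_cons_inj (m : T) u u' v v' :
  m \notin u -> m \notin u' -> u ++ m :: v = u' ++ m :: v' -> u = u' /\ v = v'.
Proof.
elim: u u' => [|a u IH] [|a' u'] //=.
- by move=> _ _ [].
- by move=> _ mu' [e _]; rewrite -e mem_head in mu'.
- by move=> mu _ [e _]; rewrite e mem_head in mu.
- rewrite !inE !negb_or => /andP[_ mu] /andP[_ mu'] [-> /IH].
  by case=> // -> ->.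
Qed.

(** An arrangement of [X] amounts to the set [Y] of letters before [m], an arrangement of [Y], and
    an arrangement of the remaining letters. *)
Lemma big_permutations_split (F : seq T -> R) (X : {set T}) (m : T) : m \in X ->
  \sum_(w <- permutations (enum X)) F w =
  \sum_(Y : {set T} | Y \subset X :\ m)
     \sum_(u <- permutations (enum Y))
     \sum_(v <- permutations (enum ((X :\ m) :\: Y))) F (u ++ m :: v).
Proof.
move=> mX; under [RHS]eq_bigl do rewrite -powersetE.
rewrite -big_enum /=.
pose P (Y : {set T}) := [seq u ++ m :: v | u <- permutations (enum Y),
                           v <- permutations (enum ((X :\ m) :\: Y))].
transitivity (\sum_(Y <- enum (powerset (X :\ m))) \sum_(w <- P Y) F w);
  last by apply: eq_bigr => Y _; rewrite big_allpairs_dep.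
have PP Y uv : uv \in P Y -> exists u v, [/\ uv = u ++ m :: v,
    perm_eq u (enum Y) & perm_eq v (enum ((X :\ m) :\: Y))].
  case/allpairsPdep => u [v] [Hu Hv ->]; exists u, v.
  by rewrite -!mem_permutations.
have mY (Y : {set T}) u : Y \in enum (powerset (X :\ m)) ->
    perm_eq u (enum Y) -> m \notin u.
  rewrite mem_enum powersetE => /subsetP YX pu.
  rewrite (perm_mem pu) mem_enum; apply/negP => /YX.
  by rewrite !inE eqxx.
rewrite -(big_allpairs_dep (h := fun _ w => w)); apply: perm_big.
apply: uniq_perm; first exact: permutations_uniq.
  apply: allpairs_uniq_dep; first exact: enum_uniq.
  - move=> Y YX; apply: allpairs_uniq_dep; try by move=> *; exact: permutations_uniq.
    move=> /= p p' /allpairsPdep[u [v [Hu _ ->]]]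
      /allpairsPdep[u' [v' [Hu' _ ->]]] /=.
    rewrite !mem_permutations in Hu Hu'.
    by case/(cat_cons_inj (mY _ _ YX Hu) (mY _ _ YX Hu')) => -> ->.
  - move=> /= p p' /allpairsPdep[Y [w [HY Hw ->]]]
      /allpairsPdep[Y' [w' [HY' Hw' ->]]] /=.
    have [u [v [ew Hu Hv]]] := PP _ _ Hw.
    have [u' [v' [ew' Hu' Hv']]] := PP _ _ Hw'.
    rewrite ew ew'.
    case/(cat_cons_inj (mY _ _ HY Hu) (mY _ _ HY' Hu')) => eu ev.
    (* The set is recovered as the letters before [m], so the lists [P Y] for different [Y] are
       disjoint. *)
    suff -> : Y = Y' by rewrite eu ev.
    apply/setP => x; rewrite -[x \in Y]mem_enum -[x \in Y']mem_enum.
    by rewrite -(perm_mem Hu) -(perm_mem Hu') eu.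
move=> w; rewrite mem_permutations; apply/idP/allpairsPdep => [pw|].
  have mw : m \in w by rewrite (perm_mem pw) mem_enum.
  have uw : uniq w by rewrite (perm_uniq pw) enum_uniq.
  case/splitPr: mw pw uw => u v pw uw.
  have /and3P[uu] : [&& uniq u, ~~ has (mem u) (m :: v) & uniq (m :: v)].
    by rewrite -cat_uniq.
  rewrite /= negb_or => /andP[mu /hasPn uv] /andP[mv uvq].
  exists [set x in u], (u ++ m :: v); split=> //.
    rewrite mem_enum powersetE; apply/subsetP => x; rewrite !inE => xu.
    apply/andP; split; first by apply: contraNneq mu => <-.
    by rewrite -[x \in X]mem_enum -(perm_mem pw) mem_cat xu.
  apply/allpairsPdep; exists u, v; rewrite !mem_permutations; split=> //.
    by apply: uniq_perm => // [|x]; rewrite ?enum_uniq // mem_enum inE.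
  apply: uniq_perm => // [|x]; rewrite ?enum_uniq // mem_enum !inE.
  rewrite -[x \in X]mem_enum -(perm_mem pw) mem_cat inE.
  have [xv|] := boolP (x \in v); last by case: (x \in u); case: (x == m).
  rewrite (uv _ xv) !orbT !andbT /=.
  by apply/esym; apply: contraNneq mv => <-.
case=> Y [w' [YX /PP[u [v [-> Hu Hv]]] ->]].
rewrite mem_enum powersetE in YX.
apply: (@perm_trans _ (enum Y ++ m :: enum ((X :\ m) :\: Y))).
  by apply: perm_cat => //; rewrite perm_cons.
have mnY : m \notin Y by apply/negP => /(subsetP YX); rewrite !inE eqxx.
apply: uniq_perm; rewrite ?enum_uniq //.
  rewrite cat_uniq /= !enum_uniq !mem_enum !inE eqxx /= !andbF !andbT.
  rewrite negb_or mnY /=; apply/hasPn => x.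
  by rewrite !mem_enum !inE => /andP[].
move=> x; rewrite mem_cat inE !mem_enum !inE.
case: eqVneq => [->|_] /=; first by rewrite orbT mX.
case: (boolP (x \in Y)) => //= xY.
by have := subsetP YX _ xY; rewrite !inE => /andP[].
Qed.

End SplitAtLetter.

(** One-line notation is injective into the arrangements, and both sides have n! terms, so
    surjectivity follows by counting. *)
Lemma big_Sn_permutations (R : nmodType) n (F : seq 'I_n -> R) :
  (\sum_(p : 'S_n) F [seq p i | i <- enum 'I_n] =
   \sum_(w <- permutations (enum 'I_n)) F w)%R.
Proof.
rewrite -(big_map (fun p : 'S_n => [seq p i | i <- enum 'I_n]) xpredT F).
apply: perm_big; rewrite /index_enum -enumT.
have u1 : uniq [seq [seq p i | i <- enum 'I_n] | p : 'S_n <- enum 'S_n].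
  rewrite map_inj_uniq ?enum_uniq // => p q e; apply/permP => i.
  by move/eq_in_map: e => ->; rewrite ?mem_enum.
apply: uniq_perm => //; first exact: permutations_uniq.
case: (uniq_min_size u1 (s2 := permutations (enum 'I_n))) => // [|].
  move=> _ /mapP[p _ ->]; rewrite mem_permutations; apply: uniq_perm.
  - by rewrite map_inj_uniq ?enum_uniq //; exact: perm_inj.
  - exact: enum_uniq.
  - move=> i; rewrite mem_enum; apply/mapP; exists (perm_inv p i).
      by rewrite mem_enum.
    by rewrite permKV.
by rewrite size_map -cardE card_Sn size_permutations ?enum_uniq ?size_enum_ord.
Qed.

(** Grouping subsets by size yields the binomial coefficients of a product of exponential generating
    functions. *)
Lemma big_subset_card (T : finType) (R : nmodType) (B : {set T}) (f : nat -> R) :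
  (\sum_(Y : {set T} | Y \subset B) f #|Y| =
   \sum_(k < #|B|.+1) f k *+ 'C(#|B|, k))%R.
Proof.
rewrite (partition_big (fun Y : {set T} => inord #|Y| : 'I_#|B|.+1) xpredT) //=.
apply: eq_bigr => k _; rewrite -cards_draws -sumr_const.
have E (Y : {set T}) : (Y \subset B) && (inord #|Y| == k :> 'I_#|B|.+1)
    = (Y \subset B) && (#|Y| == k).
  case: (boolP (Y \subset B)) => //= YB.
  by rewrite -(inj_eq val_inj) /= inordK // ltnS subset_leq_card.
rewrite (eq_bigl _ _ E); apply: eq_big => [Y|Y /andP[_ /eqP ->] //].
by rewrite inE.
Qed.

Definition word n (w : seq 'I_n) : seq nat := [seq i.+1 | i : 'I_n <- w].

Lemma word_inj n : injective (@word n).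
Proof. by apply: inj_map => i j [/val_inj]. Qed.

Lemma sorted_word_enum n (Y : {set 'I_n}) : sorted ltn (word (enum Y)).
Proof.
have -> : enum Y = filter (mem Y) (enum 'I_n)
  by rewrite /enum_mem -enumT filter_predT.
rewrite /word sorted_map; apply: sorted_filter.
  by move=> i j k; apply: ltn_trans.
have := iota_ltn_sorted 0 n; rewrite -val_enum_ord sorted_map.
exact: sub_sorted.
Qed.

(** Only [enum Y] is increasing. Increasing prefixes thus contribute one term [s ^+ #|Y|] per set,
    which is the source of e^(sx). *)
Lemma big_sorted_word (R : pzSemiRingType) n (Y : {set 'I_n}) :
  (\sum_(u <- permutations (enum Y)) (sorted ltn (word u))%:R = 1 :> R)%R.
Proof.
rewrite -natr_sum.
transitivity ((count_mem (enum Y) (permutations (enum Y)))%:R : R)%R.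
  rewrite -sum1_count [in RHS]big_mkcond; congr (_%:R)%R.
  apply: eq_big_seq => u; rewrite mem_permutations => pu /=.
  case: eqVneq => [->|ne]; first by rewrite sorted_word_enum.
  case: (boolP (sorted ltn (word u))) => // su; case/eqP: ne; apply: word_inj.
  apply: irr_sorted_eq su (sorted_word_enum Y) _ => //.
  - exact: ltn_trans.
  - exact: ltnn.
  - by move=> i; apply: perm_mem; apply: perm_map.
by rewrite count_uniq_mem ?permutations_uniq // mem_permutations perm_refl.
Qed.

(** * The recurrence for the weighted sums over words *)

Section PixDesSum.
Local Open Scope ring_scope.
Variables (R : comNzRingType) (t : R).

Definition pixdes (s : R) (w : seq nat) : R := s ^+ pix w * t ^+ des w.

(** Arbitrary letter sets are allowed because cutting at the largest letter leaves words on
    complementary subsets. *)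
Definition pixdes_sum (s : R) n (X : {set 'I_n}) : R :=
  \sum_(w <- permutations (enum X)) pixdes s (word w).

(* Contribution of the factor [v] after the largest letter when the prefix is
   not increasing, in terms of the weight [a] of [v] at s = 1; [b] tells whether
   [v] is empty. *)
Definition right_factor (a : R) (b : bool) : R := t * a + (1 - t) * b%:R.

(* The same for an increasing prefix; [d] is the weight of [v] at s = 0, which
   keeps the desarrangements only. *)
Definition right_factor_sorted (s a d : R) (b : bool) : R :=
  t * ((s - 1) * d + a) + (s - t * s) * b%:R.

(** The exponents depending on [v] are made affine: t^[v nonempty] = t + (1 - t)[v empty], and
    s^[v desarrangement] = 1 + (s - 1)[v desarrangement]. The weight becomes a sum of products of a
    function of [u] and a function of [v], so the double sum will factor. *)
Lemma pixdes_split s m u v :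
  uniq (u ++ m :: v) -> all (ltn^~ m) u -> all (ltn^~ m) v ->
  pixdes s (u ++ m :: v) =
    pixdes s u * right_factor (pixdes 1 v) (v == [::])
    + (sorted ltn u)%:R * s ^+ size u *
      (right_factor_sorted s (pixdes 1 v) (pixdes 0 v) (v == [::])
       - right_factor (pixdes 1 v) (v == [::])).
Proof.
move=> uw au av; rewrite /pixdes /right_factor /right_factor_sorted.
rewrite pix_split // des_split // expr1n !exprD expr0n.
have [uu uv] : uniq u /\ uniq v.
  by move: uw; rewrite cat_uniq /= => /and4P[? _ _ ?].
rewrite pix_eq0 //.
have Ev : v = [::] -> des v = 0%N /\ desarrangement v by move=> ->.
case: ifP => su; last first.
  by case: eqVneq => [/Ev[-> _]|_] /=; ring.
rewrite (pix_sorted uu su) (des_sorted su) exprD.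
case: eqVneq => [/Ev[-> ->]|_] /=; first by ring.
by case: (desarrangement v); rewrite /=; ring.
Qed.

Lemma pixdes_sum0 s n : pixdes_sum s (@set0 'I_n) = 1.
Proof.
by rewrite /pixdes_sum enum_set0 big_seq1 /pixdes /word /= !expr0 mulr1.
Qed.

Lemma pixdes_sum_split s n (X : {set 'I_n}) (m : 'I_n) :
  m \in X -> (forall i, i \in X -> i <= m)%N ->
  pixdes_sum s X =
  \sum_(Y : {set 'I_n} | Y \subset X :\ m)
    let Z := (X :\ m) :\: Y in
    ((pixdes_sum s Y - s ^+ #|Y|)
       * right_factor (pixdes_sum 1 Z) (#|Z| == 0%N)
     + s ^+ #|Y|
       * right_factor_sorted s (pixdes_sum 1 Z) (pixdes_sum 0 Z) (#|Z| == 0%N)).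
Proof.
move=> mX maxm; rewrite /pixdes_sum (big_permutations_split _ mX).
apply: eq_bigr => Y YX /=; set Z := _ :\: Y.
have ltm (V : {set 'I_n}) w : V \subset X :\ m -> perm_eq w (enum V) ->
    all (ltn^~ m.+1) (word w).
  move=> VX pw; apply/allP => _ /mapP[i iw ->].
  rewrite (perm_mem pw) mem_enum in iw.
  have := subsetP VX _ iw; rewrite !inE => /andP[im /maxm].
  by rewrite leq_eqVlt (inj_eq val_inj) (negbTE im).
have ZX : Z \subset X :\ m by apply: subsetDl.
(* The indicator of the empty word sums to 1 if [Z] is empty, which has one arrangement, and to 0
   otherwise. The affine factors therefore pass from words to their sums. *)
have sum_right (f : seq nat -> R) (c : R) :
    \sum_(v <- permutations (enum Z)) (f (word v) + c * (word v == [::])%:R)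
    = \sum_(v <- permutations (enum Z)) f (word v) + c * (#|Z| == 0%N)%:R.
  rewrite big_split /= -mulr_sumr; congr (_ + c * _).
  rewrite (eq_big_seq (fun=> (#|Z| == 0%N)%:R)); last first.
    move=> v; rewrite mem_permutations => /perm_size sv.
    by rewrite -size_eq0 size_map sv -cardE.
  case: (eqVneq #|Z| 0%N) => [/cards0_eq ->|_] /=.
    by rewrite enum_set0 big_seq1.
  by rewrite big1.
pose rf1 (v : seq 'I_n) :=
  right_factor (pixdes 1 (word v)) (word v == [::] :> seq nat).
pose rf2 (v : seq 'I_n) :=
  right_factor_sorted s (pixdes 1 (word v)) (pixdes 0 (word v))
    (word v == [::] :> seq nat).
have S1 : \sum_(v <- permutations (enum Z)) rf1 v =
    right_factor (\sum_(v <- permutations (enum Z)) pixdes 1 (word v)) (#|Z| == 0%N).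
  by rewrite /rf1 /right_factor (sum_right (fun v => t * pixdes 1 v)) mulr_sumr.
have S2 : \sum_(v <- permutations (enum Z)) rf2 v =
    right_factor_sorted s (\sum_(v <- permutations (enum Z)) pixdes 1 (word v))
      (\sum_(v <- permutations (enum Z)) pixdes 0 (word v)) (#|Z| == 0%N).
  rewrite /rf2 /right_factor_sorted.
  rewrite (sum_right (fun v => t * ((s - 1) * pixdes 0 v + pixdes 1 v))).
  by rewrite -mulr_sumr big_split /= -mulr_sumr.
rewrite -S1 -S2.
transitivity (\sum_(u <- permutations (enum Y)) \sum_(v <- permutations (enum Z))
   (pixdes s (word u) * rf1 v
    + (sorted ltn (word u))%:R * s ^+ #|Y| * (rf2 v - rf1 v))).
  apply: eq_big_seq => u; rewrite mem_permutations => pu.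
  apply: eq_big_seq => v; rewrite mem_permutations => pv.
  have -> : word (u ++ m :: v) = word u ++ m.+1 :: word v by rewrite /word map_cat.
  have uw : uniq (word u ++ m.+1 :: word v).
    rewrite -[m.+1 :: _]/(word (m :: v)) -map_cat map_inj_uniq; last first.
      by move=> i j [/val_inj].
    rewrite cat_uniq /= (perm_uniq pu) (perm_uniq pv) !enum_uniq /= andbT.
    rewrite (perm_mem pu) (perm_mem pv) negb_or !mem_enum !inE eqxx andbF andbT.
    apply/andP; split; first by apply/negP => /(subsetP YX); rewrite !inE eqxx.
    apply/hasPn => i; rewrite /= (perm_mem pu) (perm_mem pv) !mem_enum.
    by rewrite !inE => /andP[].
  rewrite (pixdes_split s uw (ltm Y u YX pu) (ltm Z v ZX pv)).
  by rewrite size_map (perm_size pu) -cardE.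
transitivity (\sum_(u <- permutations (enum Y))
   (pixdes s (word u) * (\sum_(v <- permutations (enum Z)) rf1 v)
    + (sorted ltn (word u))%:R * (s ^+ #|Y| *
       (\sum_(v <- permutations (enum Z)) rf2 v
        - \sum_(v <- permutations (enum Z)) rf1 v)))).
  apply: eq_bigr => u _; rewrite big_split /= -!mulr_sumr.
  by rewrite sumrB mulrA.
rewrite big_split /= -!mulr_suml big_sorted_word.
ring.
Qed.

(** The differential equation for G_s with its initial value, read on coefficients multiplied by n!;
    [a], [d] and [g] stand for A, D and G_s. *)
Definition pixdes_recurrence (s : R) (a d g : nat -> R) : Prop :=
  g 0%N = 1 /\ forall n, g n.+1 = \sum_(k < n.+1)
    ((g k - s ^+ k) * right_factor (a (n - k)%N) (n - k == 0)%N
     + s ^+ k * right_factor_sorted s (a (n - k)%N) (d (n - k)%N) (n - k == 0)%N)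
    *+ 'C(n, k).

(** The recurrence determines its solution by induction on the size of [X]. The parameters 1, 0 and
    s are treated together, since the equation for s involves the sums at 1 and 0. *)
Lemma pixdes_sum_recurrence (s : R) (a d g : nat -> R) :
  pixdes_recurrence 1 a d a -> pixdes_recurrence 0 a d d ->
  pixdes_recurrence s a d g ->
  forall n (X : {set 'I_n}), pixdes_sum s X = g #|X|.
Proof.
move=> ra rd rg n.
suff H k (X : {set 'I_n}) : (#|X| <= k)%N -> [/\ pixdes_sum 1 X = a #|X|,
    pixdes_sum 0 X = d #|X| & pixdes_sum s X = g #|X|].
  by move=> X; have [] := H _ X (leqnn _).
elim: k X => [|k IH] X leX.
  move: leX; rewrite leqn0 cards_eq0 => /eqP ->; rewrite cards0 !pixdes_sum0.
  by rewrite (proj1 ra) (proj1 rd) (proj1 rg).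
have [X0|/set0Pn[x0 x0X]] := eqVneq X set0.
  by rewrite X0 cards0 !pixdes_sum0 (proj1 ra) (proj1 rd) (proj1 rg).
have [m mX maxm] : exists2 m, m \in X & forall i, i \in X -> (i <= m)%N.
  by have [m mX maxm] := arg_maxnP (fun i : 'I_n => i : nat) x0X; exists m.
have cX : #|X| = #|X :\ m|.+1 by rewrite (cardsD1 m X) mX.
have step s' g' :
    (forall Y : {set 'I_n}, (#|Y| <= k)%N -> pixdes_sum s' Y = g' #|Y|) ->
    pixdes_recurrence s' a d g' -> pixdes_sum s' X = g' #|X|.
  move=> IHs rs; rewrite (pixdes_sum_split s' mX maxm) cX (proj2 rs).
  rewrite -(big_subset_card (X :\ m) (fun j => (g' j - s' ^+ j)
    * right_factor (a (#|X :\ m| - j)%N) (#|X :\ m| - j == 0)%N + s' ^+ j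
    * right_factor_sorted s' (a (#|X :\ m| - j)%N) (d (#|X :\ m| - j)%N)
        (#|X :\ m| - j == 0)%N)).
  apply: eq_bigr => Y YX /=; set Z := _ :\: Y.
  have cZ : (#|X :\ m| - #|Y| = #|Z|)%N by rewrite (cardsD (X :\ m)) (setIidPr YX).
  have lek (V : {set 'I_n}) : V \subset X :\ m -> (#|V| <= k)%N.
    by move=> /subset_leq_card VX; apply: leq_trans VX _; rewrite -ltnS -cX.
  have [-> -> _] := IH Z (lek Z (subsetDl _ _)).
  by rewrite cZ IHs // lek.
by split; apply: step => // Y /IH[].
Qed.

End PixDesSum.

(** * The ring of formal power series and its derivation *)

Section FpsRing.
Local Open Scope ring_scope.
Variable F : fieldType.
Implicit Types (f g h : fps F) (c : F).

Definition fps_opp f : fps F := fun n => - f n.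
Definition fps_trunc n f : {poly F} := \poly_(i < n.+1) f i.

(* Truncation transports the ring laws of polynomials to power series. *)
Lemma fps_mul_trunc N f g n : (n <= N)%N ->
  fps_mul f g n = (fps_trunc N f * fps_trunc N g)`_n.
Proof.
move=> nN; rewrite coefM; apply: eq_bigr => i _; rewrite !coef_poly !ltnS.
by rewrite (leq_trans (leq_subr _ _) nN) (leq_trans _ nN) // -ltnS.
Qed.

Lemma fps_addA : associative (@fps_add F).
Proof. by move=> f g h; apply/funext => n; apply: addrA. Qed.

Lemma fps_addC : commutative (@fps_add F).
Proof. by move=> f g; apply/funext => n; apply: addrC. Qed.

Lemma fps_add0 : left_id (fps_const 0) (@fps_add F).
Proof. by move=> f; apply/funext => -[|n]; apply: add0r. Qed.

Lemma fps_addN : left_inverse (fps_const 0) fps_opp (@fps_add F).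
Proof. by move=> f; apply/funext => -[|n]; apply: addNr. Qed.

Lemma fps_mulC : commutative (@fps_mul F).
Proof.
by move=> f g; apply/funext => n; rewrite !(@fps_mul_trunc n) // mulrC.
Qed.

Lemma fps_mulA : associative (@fps_mul F).
Proof.
move=> f g h; apply/funext => n.
transitivity ((fps_trunc n f * fps_trunc n g * fps_trunc n h)`_n).
  rewrite -mulrA coefM; apply: eq_bigr => i _.
  by rewrite coef_poly ltn_ord (@fps_mul_trunc n) ?leq_subr.
rewrite coefM; apply: eq_bigr => i _.
by rewrite coef_poly ltnS leq_subr (@fps_mul_trunc n) // -ltnS.
Qed.

Lemma fps_mul1 : left_id (fps_const 1) (@fps_mul F).
Proof.
move=> f; apply/funext => n; rewrite /fps_mul big_ord_recl mul1r subn0.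
by rewrite big1 ?addr0 // => i _; rewrite mul0r.
Qed.

Lemma fps_mulDl : left_distributive (@fps_mul F) (@fps_add F).
Proof.
move=> f g h; apply/funext => n; rewrite /fps_mul /fps_add -big_split.
by apply: eq_bigr => i _; rewrite mulrDl.
Qed.

Lemma fps_1neq0 : fps_const 1 != fps_const 0 :> (nat -> F).
Proof. by apply/eqP => /(congr1 (@^~ 0%N)) /eqP; rewrite /= oner_eq0. Qed.

(** Functional extensionality has turned the pointwise laws into equalities, so series form a
    commutative ring on which [ring] works. *)
HB.instance Definition _ := gen_eqMixin (fps F).
HB.instance Definition _ := gen_choiceMixin (fps F).
HB.instance Definition _ := GRing.isZmodule.Build (fps F)
  fps_addA fps_addC fps_add0 fps_addN.
HB.instance Definition _ := GRing.Zmodule_isComNzRing.Build (fps F)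
  fps_mulA fps_mulC fps_mul1 fps_mulDl fps_1neq0.

Lemma fps_const_is_additive : {morph @fps_const F : c d / c - d}.
Proof. by move=> c d; apply/funext => -[|n] //; apply/esym/subr0. Qed.

HB.instance Definition _ := GRing.isZmodMorphism.Build F (fps F) (@fps_const F)
  fps_const_is_additive.

Lemma fps_const_is_multiplicative : monoid_morphism (@fps_const F).
Proof.
split=> // c d; apply/funext => -[|n]; rewrite -[RHS]/(fps_mul _ _ _) /fps_mul.
  by rewrite big_ord1.
by rewrite big1 // => -[[|i] Hi] _ /=; rewrite ?mulr0 ?mul0r.
Qed.

HB.instance Definition _ := GRing.isMonoidMorphism.Build F (fps F) (@fps_const F)
  fps_const_is_multiplicative.

Lemma fps_scaleE c f : fps_scale c f = fps_const c * f.
Proof.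
apply/funext => n; rewrite -[RHS]/(fps_mul _ _ _) /fps_mul big_ord_recl subn0.
by rewrite big1 ?addr0 // => i _; rewrite mul0r.
Qed.

Lemma fps_mulE f g : fps_mul f g = f * g.
Proof. by []. Qed.

Lemma fps_addE f g : fps_add f g = f + g.
Proof. by []. Qed.

Lemma fps_subE f g : fps_sub f g = f - g.
Proof. by []. Qed.

Lemma coef_fpsM f g n : (f * g) n = \sum_(i < n.+1) f i * g (n - i)%N.
Proof. by []. Qed.

Lemma coef_fpsD f g n : (f + g) n = f n + g n.
Proof. by []. Qed.

Lemma coef_fpsB f g n : (f - g) n = f n - g n.
Proof. by []. Qed.

Lemma coef_fpsCM c f n : (fps_const c * f) n = c * f n.
Proof. by rewrite -fps_scaleE. Qed.

Lemma fps_invM c f : c != 0 -> f 0%N != 0 ->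
  fps_inv (fps_scale c f) = fps_const c^-1 * fps_inv f.
Proof.
move=> c0 f0.
have E : f * fps_inv f = 1 by apply/funext => n; apply: fps_mulV.
have : fps_scale c f * fps_inv (fps_scale c f) = 1.
  by apply/funext => n; apply: fps_mulV; rewrite mulf_neq0.
(* Uniqueness of inverses: the identity is multiplied by the candidate inverse. *)
rewrite fps_scaleE => /(congr1 (fun z => fps_const c^-1 * fps_inv f * z)).
rewrite mulr1 => <-; set y := fps_inv _.
transitivity (fps_const (c^-1 * c) * (f * fps_inv f) * y); last by ring.
by rewrite mulVf // E !mulr1 mul1r.
Qed.

Definition fps_deriv f : fps F := fun n => n.+1%:R * f n.+1.

Lemma fps_derivD f g : fps_deriv (f + g) = fps_deriv f + fps_deriv g.
Proof. by apply/funext => n; apply: mulrDr. Qed.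

Lemma fps_derivB f g : fps_deriv (f - g) = fps_deriv f - fps_deriv g.
Proof. by apply/funext => n; apply: mulrBr. Qed.

Lemma fps_derivC c : fps_deriv (fps_const c) = 0.
Proof. by apply/funext => n; rewrite /fps_deriv mulr0; case: n. Qed.

Lemma fps_derivM f g :
  fps_deriv (f * g) = fps_deriv f * g + f * fps_deriv g.
Proof.
apply/funext => n; rewrite coef_fpsD !coef_fpsM /fps_deriv coef_fpsM.
(* The factor n + 1 is split as i + (n + 1 - i); each half then loses one vanishing boundary
   term. *)
transitivity (\sum_(i < n.+2) (i%:R * f i * g (n.+1 - i)%N
                             + f i * ((n.+1 - i)%:R * g (n.+1 - i)%N))).
  rewrite mulr_sumr; apply: eq_bigr => i _.
  have -> : n.+1%:R = i%:R + (n.+1 - i)%:R :> F.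
    by rewrite -natrD subnKC // -ltnS.
  ring.
rewrite big_split /=; congr (_ + _).
  rewrite big_ord_recl !mul0r add0r; apply: eq_bigr => i _.
  by rewrite /= /bump /= add1n subSS.
rewrite big_ord_recr /= subnn mul0r mulr0 addr0; apply: eq_bigr => i _.
by rewrite subSn // -ltnS.
Qed.

(** * Exponential series in characteristic zero *)

Section CharZero.
Hypothesis F0 : [pchar F] =i pred0.

Lemma fact_neq0 n : n`!%:R != 0 :> F.
Proof. by rewrite (proj1 (pcharf0P F) F0) -lt0n fact_gt0. Qed.

Lemma fps_derivE c : fps_deriv (fps_exp c) = fps_const c * fps_exp c.
Proof.
apply/funext => n; rewrite coef_fpsCM /fps_deriv /fps_exp factS natrM exprS.
have n0 : n.+1%:R != 0 :> F by rewrite (proj1 (pcharf0P F) F0).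
move: n0; move: (n.+1%:R : F) => N n0.
by field; rewrite fact_neq0 n0.
Qed.

Lemma fps_expD c d : fps_exp (c + d) = fps_exp c * fps_exp d.
Proof.
apply/funext => n; rewrite coef_fpsM /fps_exp addrC exprDn mulr_suml.
apply: eq_bigr => i _; have lein : (i <= n)%N by rewrite -ltnS.
have := congr1 (fun k => k%:R : F) (bin_fact lein); rewrite !natrM => <-.
rewrite -mulr_natr.
have b0 : 'C(n, i)%:R != 0 :> F by rewrite (proj1 (pcharf0P F) F0) -lt0n bin_gt0.
by field; rewrite b0 !fact_neq0.
Qed.

End CharZero.
End FpsRing.

(** * Solving the differential equation *)

Section ClosedForm.
Local Open Scope ring_scope.
Variables (F : fieldType) (t : F).
Hypotheses (F0 : [pchar F] =i pred0).
Hypotheses (t0 : t != 0) (t1 : 1 - t != 0) (t2 : 1 - 2 * t != 0).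
Implicit Type s : F.

Local Notation q := (fps_exp (t - 1) - fps_const t).

Definition eulerian_egf : fps F := fps_const (1 - t) * fps_inv q.

(** The series y_s. Its exponentials are obtained by integrating (s - 1) e^(sx) (q + t y_0), and its
    constant term is fixed by y_s(0) = 1. *)
Definition pix_factor s : fps F :=
  fps_const (- (1 - t) * t / ((1 - s - t) * (s - t)))
  + fps_const ((1 - s) * (1 - t) / ((1 - 2 * t) * (1 - s - t)))
      * fps_exp (s + t - 1)
  + fps_const (t * (1 - s) / ((1 - 2 * t) * (s - t))) * fps_exp (s - t).

Definition pixdes_closed s : fps F := eulerian_egf * pix_factor s.

(** Both exponents in [pix_factor] are nonzero, as integration divides by them. *)
Definition regular s := (1 - s - t != 0) && (s - t != 0).

Lemma eulerian_den_coef0 : q 0%N = 1 - t.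
Proof. by rewrite coef_fpsB /fps_exp expr0 fact0 divr1. Qed.

Lemma eulerian_den_mulV : q * fps_inv q = 1.
Proof. by apply/funext => n; apply: fps_mulV; rewrite eulerian_den_coef0. Qed.

Lemma eulerian_egf_deriv : fps_deriv eulerian_egf
  = eulerian_egf * (fps_const (1 - t) + fps_const t * eulerian_egf).
Proof.
have dq : fps_deriv q * fps_inv q + q * fps_deriv (fps_inv q) = 0.
  by rewrite -fps_derivM eulerian_den_mulV fps_derivC.
rewrite /eulerian_egf fps_derivM fps_derivC mul0r add0r.
have -> : fps_deriv (fps_inv q) = - fps_deriv q * fps_inv q * fps_inv q.
  transitivity (fps_inv q * (q * fps_deriv (fps_inv q))).
    by rewrite mulrA (mulrC (fps_inv q)) eulerian_den_mulV mul1r.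
  by rewrite -[q * _](addKr (fps_deriv q * fps_inv q)) dq; ring.
(* This is e^((t-1)x) = q + t divided by q; it removes the exponential from q'. *)
have E : fps_exp (t - 1) * fps_inv q = 1 + fps_const t * fps_inv q.
  by rewrite -eulerian_den_mulV; ring.
move: E; rewrite fps_derivB fps_derivE // fps_derivC.
set W := fps_inv q; set u := fps_exp _ => E.
transitivity (fps_const (1 - t) ^+ 2 * W * (u * W)); first by ring.
by rewrite E; ring.
Qed.

Lemma pix_factor_deriv s : regular s -> fps_deriv (pix_factor s) =
  fps_const (s - 1) * fps_exp s * (q + fps_const t * pix_factor 0).
Proof.
case/andP => s1 s2; rewrite /pix_factor.
rewrite !fps_derivD !fps_derivM !fps_derivC !fps_derivE //.
have -> : s + t - 1 = s + (t - 1) by ring.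
rewrite [fps_exp (s + _)]fps_expD // [fps_exp (s - t)]fps_expD //.
rewrite !sub0r !add0r subr0 !mul1r.
set E := fps_exp s; set u := fps_exp (t - 1); set v := fps_exp (- t).
set p := (1 - 2 * t)^-1.
(* With p = 1 / (1 - 2t), the coefficients at s = 0 give y_0 = 1 + p (e^((t-1)x) - e^(-tx)). Hence
   the constants of q and t y_0 cancel and only two exponentials remain. *)
have -> : - (1 - t) * t / ((1 - t) * - t) = 1
  by field; rewrite ?oppr_eq0 ?t0 ?t1.
have -> : (1 - t) / ((1 - 2 * t) * (1 - t)) = p
  by rewrite /p; field; rewrite ?oppr_eq0 ?t1 ?t2.
have -> : t * 1 / ((1 - 2 * t) * - t) = - p
  by rewrite /p; field; rewrite ?oppr_eq0 ?t0 ?t2.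
transitivity (
  fps_const ((1 - s) * (1 - t) / ((1 - 2 * t) * (1 - s - t)) * (s + (t - 1)))
    * (E * u)
  + fps_const (t * (1 - s) / ((1 - 2 * t) * (s - t)) * (s - t)) * (E * v));
  first by ring.
have -> : (1 - s) * (1 - t) / ((1 - 2 * t) * (1 - s - t)) * (s + (t - 1))
    = (s - 1) * (1 + t * p).
  by rewrite /p; field; rewrite s1 t2.
have -> : t * (1 - s) / ((1 - 2 * t) * (s - t)) * (s - t) = - (s - 1) * t * p.
  by rewrite /p; field; rewrite s2 t2.
ring.
Qed.

Lemma regular0 : regular 0.
Proof. by rewrite /regular subr0 t1 sub0r oppr_eq0. Qed.

Lemma regular1 : regular 1.
Proof. by rewrite /regular subrr sub0r oppr_eq0 t0. Qed.

Lemma pix_factor1 : pix_factor 1 = 1.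
Proof.
rewrite /pix_factor !subrr sub0r !(mulr0, mul0r) !addr0.
by rewrite (_ : _ / _ = 1) //; field; rewrite oppr_eq0 t0 t1.
Qed.

Lemma pixdes_closed1 : pixdes_closed 1 = eulerian_egf.
Proof. by rewrite /pixdes_closed pix_factor1 mulr1. Qed.

Lemma pixdes_closed_deriv s : regular s ->
  fps_deriv (pixdes_closed s) =
  (pixdes_closed s - fps_exp s)
    * (fps_const (1 - t) + fps_const t * pixdes_closed 1)
  + fps_exp s * (fps_const (s - t * s) + fps_const t *
      (fps_const (s - 1) * pixdes_closed 0 + pixdes_closed 1)).
Proof.
move=> rs; rewrite pixdes_closed1 /pixdes_closed fps_derivM eulerian_egf_deriv.
rewrite pix_factor_deriv //.
(* Multiplying the equation for y_s by A turns A q into this constant and A y_0 into the solution at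
   s = 0. *)
have Aq : eulerian_egf * q = fps_const (1 - t).
  by rewrite /eulerian_egf -mulrA (mulrC (fps_inv q)) eulerian_den_mulV mulr1.
set A := eulerian_egf in Aq *; set y0 := pix_factor 0; set y := pix_factor s.
transitivity (A * (fps_const (1 - t) + fps_const t * A) * y
  + fps_const (s - 1) * fps_exp s * (A * q + fps_const t * (A * y0))).
  by ring.
by rewrite Aq; ring.
Qed.

Lemma pixdes_closed_coef0 s : regular s -> pixdes_closed s 0%N = 1.
Proof.
case/andP => s1 s2; rewrite /pixdes_closed coef_fpsM big_ord1 subnn.
have -> : eulerian_egf 0%N = 1
  by rewrite /eulerian_egf coef_fpsCM /fps_inv /= eulerian_den_coef0 mulfV.
rewrite mul1r /pix_factor !coef_fpsD !coef_fpsCM /fps_exp !expr0 fact0 divr1 /=.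
by field; rewrite s1 s2 t2.
Qed.

Lemma pixdes_closed_recurrence s : regular s ->
  pixdes_recurrence t s (fun n => n`!%:R * pixdes_closed 1 n)
    (fun n => n`!%:R * pixdes_closed 0 n) (fun n => n`!%:R * pixdes_closed s n).
Proof.
move=> rs; split=> [|n]; first by rewrite pixdes_closed_coef0 // mulr1.
(* The left side is n! times the coefficient of x^n in the derivative. *)
rewrite factS mulnC natrM -mulrA -[_.+1%:R * _]/(fps_deriv _ n).
rewrite pixdes_closed_deriv // coef_fpsD !coef_fpsM -big_split mulr_sumr.
apply: eq_bigr => i _; have lein : (i <= n)%N by rewrite -ltnS.
have -> : n`!%:R = 'C(n, i)%:R * (i`!%:R * (n - i)`!%:R) :> F.
  by rewrite -!natrM bin_fact.
rewrite coef_fpsB !coef_fpsD !coef_fpsCM !coef_fpsD !coef_fpsCM.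
rewrite /right_factor /right_factor_sorted -mulr_natr /fps_exp.
have f0 := fact_neq0 F0 i.
(* Constant series contribute only at index 0, matching the indicators of the empty suffix. *)
case: (n - i)%N => [|j] /=; rewrite ?fact0; field; exact: f0.
Qed.

Lemma pixdes_egf_closed s n : regular s ->
  (\sum_(p : 'S_n) s ^+ pix (oneline p) * t ^+ des (oneline p)) / n`!%:R
  = pixdes_closed s n.
Proof.
move=> rs; have := pixdes_sum_recurrence (pixdes_closed_recurrence regular1)
  (pixdes_closed_recurrence regular0) (pixdes_closed_recurrence rs) [set: 'I_n].
rewrite cardsT card_ord /pixdes_sum => E.
apply: (canLR (mulfK (fact_neq0 F0 n))); rewrite mulrC -E.
rewrite (perm_big (permutations (enum 'I_n))) /=; last first.
  by rewrite enum_setT -enumT.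
rewrite -(big_Sn_permutations (fun w => pixdes t s (word w))).
by apply: eq_bigr => p _; rewrite /pixdes /word -map_comp.
Qed.

Lemma pixdes_closedE s : regular s ->
  pixdes_closed s =
  ((1 - t)%R *:
     (((1 - s) * (1 - s - t) * t)%R *: 'e^((s - t) x)
      + (1 - t)%R *: (((1 - s) * (s - t))%R *: 'e^((s + t - 1) x)
                      - (t * (1 - 2 * t))%R%:S))
   / (((1 - 2 * t) * (1 - s - t) * (s - t))%R *: ('e^((t - 1) x) - t%:S)))%fps.
Proof.
case/andP => s1 s2; rewrite fps_invM; last first.
- by move: t1; rewrite -eulerian_den_coef0.
- exact: mulf_neq0 (mulf_neq0 t2 s1) s2.
rewrite !fps_scaleE /pixdes_closed /eulerian_egf /pix_factor.
set W := fps_inv _; set u := fps_exp (s + _ - _); set v := fps_exp (s - _).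
(* The three coefficients of [pix_factor] are brought over this common denominator. *)
set c := (1 - 2 * t) * _ * _.
set k0 := _ / _; set k1 := _ / _; set k2 := _ / _.
have -> : k0 = c^-1 * - ((1 - t) * (t * (1 - 2 * t))).
  by rewrite /k0 /c; field; rewrite s1 s2 t2.
have -> : k1 = c^-1 * ((1 - t) * ((1 - s) * (s - t))).
  by rewrite /k1 /c; field; rewrite s1 s2 t2.
have -> : k2 = c^-1 * ((1 - s) * (1 - s - t) * t).
  by rewrite /k2 /c; field; rewrite s1 s2 t2.
move: (c^-1) => {}c; rewrite fps_mulE fps_addE fps_subE; ring.
Qed.

End ClosedForm.

(** * Nonvanishing in Q(s, t) and the final identity *)

Lemma Qst_pchar0 : ([pchar Qst] =i pred0)%R.
Proof.
apply/pcharf0P => n.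
rewrite -(rmorph_nat (@tofrac {mpoly rat[2]})) tofrac_eq0.
by rewrite -(rmorph_nat (@mpolyC 2 rat)) mpolyC_eq0 Num.Theory.pnatr_eq0.
Qed.

Section Nonzero.
Local Open Scope ring_scope.

(** A polynomial with a nonzero value at one rational point is nonzero; each denominator is checked
    at a suitable point. *)
Lemma tofrac_neq0 (v : 'I_2 -> rat) (p : {mpoly rat[2]}) :
  p.@[v] != 0 -> tofrac p != 0.
Proof.
by apply: contraNneq => /eqP; rewrite tofrac_eq0 => /eqP ->; rewrite meval0.
Qed.

Lemma t_neq0 : t != 0.
Proof. by apply: (@tofrac_neq0 (fun=> 1)); rewrite mevalXU. Qed.

Lemma t_neq1 : 1 - t != 0.
Proof.
rewrite /t -(rmorph1 (@tofrac _)) -rmorphB; apply: (@tofrac_neq0 (fun=> 0)).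
by rewrite mevalB meval1 mevalXU.
Qed.

Lemma t_neq_half : 1 - 2 * t != 0.
Proof.
rewrite /t -(rmorph1 (@tofrac _)) -(rmorph_nat (@tofrac _)) -rmorphM -rmorphB.
apply: (@tofrac_neq0 (fun=> 0)).
by rewrite mevalB mevalM meval1 mevalXU mulr0.
Qed.

Lemma s_regular : regular t s.
Proof.
rewrite /regular /s /t; apply/andP; split.
  rewrite -(rmorph1 (@tofrac _)) -!rmorphB; apply: (@tofrac_neq0 (fun=> 0)).
  by rewrite !mevalB meval1 !mevalXU.
(* Since s - t vanishes at the origin, the point s = 1, t = 0 is used. *)
rewrite -rmorphB; apply: (@tofrac_neq0 (fun i => (i == ord0)%:R)).
by rewrite mevalB !mevalXU.
Qed.

End Nonzero.

Theorem theorem2p6 :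
  pix_des_egf =1
  ((1 - t)%R *:
     (((1 - s) * (1 - s - t) * t)%R *: 'e^((s - t) x)
      + (1 - t)%R *: (((1 - s) * (s - t))%R *: 'e^((s + t - 1) x)
                      - (t * (1 - 2 * t))%R%:S))
   / (((1 - 2 * t) * (1 - s - t) * (s - t))%R *: ('e^((t - 1) x) - t%:S)))%fps.
Proof.
move=> n; rewrite -(pixdes_closedE t_neq1 t_neq_half s_regular).
exact: (pixdes_egf_closed Qst_pchar0 t_neq0 t_neq1 t_neq_half n s_regular).
Qed.
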